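(* Let $G=(V,E)$ be a simple, finite, connected, undirected graph, let $d_v$ denote the degree of $v\in V$, and let $\lambda(G)$ be the spectral radius (largest eigenvalue) of the adjacency matrix of $G$. For any $\alpha\in\mathbb{R}$, $$\lambda(G)\ \ge\ \frac{2R_\alpha(G)}{\sum_{v\in V}(d_v)^{2\alpha}},\qquad\text{where } R_\alpha(G)=\sum_{vw\in E}(d_vd_w)^\alpha$$ is the Randi\'c index of $G$. Consequently, within the class $\mathcal{C}_\pi$ of all connected graphs with a given degree sequence $\pi$, graphs having a large Randi\'c index also have high topological entropy $H(G)=\log\lambda(G)$.
   Context: Graphs are simple, finite, connected and undirected. The sum in $R_\alpha(G)$ is over the edges of $G$. The topological entropy $H(G)$ of $G$ is the topological entropy of the vertex shift on $G$, i.e. $H(G)=\lim_{k\to\infty}\frac{1}{k}\log|B_k|$, where $B_k$ is the set of blocks of $k$ consecutive vertex labels (distinct vertices having distinct labels) occurring in bi-infinite walks on $G$; it equals $\log\lambda(G)$. Here $\log$ is the logarithm in base $2$. A degree sequence $\pi=(d_0,\dots,d_{n-1})$ is a non-increasing sequence of nonnegative integers for which there is a graph on $n$ vertices with vertex degrees $d_i$; $\mathcal{C}_\pi$ is the set of all connected graphs with degree sequence $\pi$. *)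

(* Defs.v *)
From HB Require Import structures.
From mathcomp Require Import all_boot all_order all_algebra.
From mathcomp Require Import complex.
From mathcomp Require Import all_classical all_reals all_analysis.

Set Implicit Arguments.
Unset Strict Implicit.
Unset Printing Implicit Defensive.

Import Order.TTheory GRing.Theory Num.Theory.
Import numFieldNormedType.Exports.

Local Open Scope classical_set_scope.
Local Open Scope ring_scope.

Record sgraph := SGraph {
  vertex :> finType;
  adj : rel vertex;
  adj_sym : symmetric adj;
  adj_irrefl : irreflexive adj
}.

Definition connected_graph (G : sgraph) : Prop :=
  (0 < #|G|)%N /\ forall v w : G, connect (@adj G) v w.

Definition deg (G : sgraph) (v : G) : nat := #|[set w | adj v w]%SET|.

Definition edges (G : sgraph) : {set {set G}} :=
  [set [set p.1; p.2]%SET | p in [pred p : G * G | adj p.1 p.2]]%SET.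

(* The product over the two elements v, w of an edge is d_v * d_w.
   [powR] extends real powers to base 0 by [0 `^ a = (a == 0)%:R]; in a
   connected graph this is relevant only for the one-vertex graph. *)
Definition randic (R : realType) (a : R) (G : sgraph) : R :=
  \sum_(E in edges G) ((\prod_(v in E) deg v)%N%:R `^ a).

Definition adjmx (R : realType) (G : sgraph) : 'M[R]_#|G| :=
  \matrix_(i, j) (adj (enum_val i) (enum_val j))%:R.

(* Complex eigenvalues; the set is finite, and nonempty if n > 0, so that the
   supremum is then a maximum. *)
Definition spectral_radius (R : realType) (n : nat) (A : 'M[R]_n) : R :=
  sup [set complex.Re `|z| | z in
         [set z : R[i] | eigenvalue (map_mx (real_complex R) A) z]].

Definition is_largest_eigenvalue (R : realType) (n : nat) (A : 'M[R]_n)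
    (l : R) : Prop :=
  eigenvalue A l /\ forall x, eigenvalue A x -> x <= l.

Definition lambda (R : realType) (G : sgraph) : R :=
  spectral_radius (adjmx R G).

Definition biinfinite_walk (G : sgraph) (x : int -> G) : Prop :=
  forall i : int, adj (x i) (x (i + 1)).

Definition blocks (G : sgraph) (k : nat) : {set k.-tuple G} :=
  [set w : k.-tuple G | `[< exists x : int -> G, biinfinite_walk x /\
     exists m : int, forall j : 'I_k, tnth w j = x (m + (j : nat)%:Z) >]]%SET.

(* Base-2 logarithm; it is -oo at 0 (and below), so the one-vertex graph, which
   has no bi-infinite walk, has entropy -oo. *)
Definition log2e (R : realType) (x : R) : \bar R :=
  (lne x%:E * ((ln 2)^-1)%:E)%E.

Definition block_rate (R : realType) (G : sgraph) (k : nat) : \bar R :=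
  ((k%:R^-1)%:E * log2e (#|blocks G k|%:R : R))%E.

Definition entropy (R : realType) (G : sgraph) : \bar R :=
  limn (block_rate R G).

Definition degree_sequence (p : seq nat) : Prop :=
  sorted geq p /\
  exists G : sgraph, perm_eq [seq deg v | v <- enum G] p.

Definition in_class (p : seq nat) (G : sgraph) : Prop :=
  connected_graph G /\ perm_eq [seq deg v | v <- enum G] p.

(* Lower bound on the entropy of a graph in the class of p whose Randic index
   is r; it depends on the graph through r only. *)
Definition entropy_bound (R : realType) (a : R) (p : seq nat) (r : R) : \bar R :=
  log2e (2 * r / \sum_(d <- p) (d%:R `^ (2 * a))).

(* Main.v *)
Require Import Defs.
From mathcomp Require Import all_boot all_order all_algebra.
From mathcomp Require Import complex ring lra zify.
From mathcomp Require Import all_classical all_reals all_analysis.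
Set Implicit Arguments.
Unset Strict Implicit.
Unset Printing Implicit Defensive.
Import Order.TTheory GRing.Theory Num.Theory.
Import numFieldNormedType.Exports.
Local Open Scope classical_set_scope.
Local Open Scope ring_scope.

(** The bound is the Rayleigh inequality [u A u^T <= lambda u u^T] for the
    adjacency matrix [A] and the test vector [u_v = d_v ^ a]: each edge
    contributes twice to [u A u^T], which is therefore [2 R_a(G)], while
    [u u^T] is the sum of the [d_v ^ (2 a)] ([bform_powdeg]).

    Everything known about [lambda] is drawn from one object, an eigenvector
    [x] of [A] with positive entries.  A symmetric nonnegative matrix has a
    nonnegative eigenvector because its quadratic form attains a maximum on the
    unit sphere, taking absolute values of the entries does not decrease the
    form, and a maximizer is an eigenvector ([nonneg_eigenvector]).  In a
    connected graph no entry of it vanishes, since a zero entry forces zeros at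
    all neighbours ([perron_vector]).  Let [m] be the eigenvalue of [x].
    - Pairing [|y|] with [x], for [y] a complex eigenvector of eigenvalue [z],
      gives [|z| <= m] ([complex_eigenvalue_le]); so [m] is the spectral radius
      ([spectral_radius_perron]).
    - The weighted arithmetic-geometric mean inequality
      [2 u_i u_j <= u_j^2 x_i / x_j + u_i^2 x_j / x_i] gives the Rayleigh
      inequality with constant [m] ([rayleigh_le]).
    - If every walk is weighted by the entry of [x] at its end, the walks with
      [k] steps have total weight [m ^ k] times the sum of [x] ([sum_walks]).
      As the entries of [x] are bounded above and below by positive constants,
      the number of blocks of length [k + 1] is [m ^ k] up to constant factors
      ([card_blocks_bounds]), so the entropy is [log2 m] ([block_rate_cvg]).
      This uses that every walk extends to a bi-infinite one, which holds as
      soon as each vertex has a neighbour ([blocks_walks]).  The one-vertex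
      graph has no bi-infinite walk and [lambda = 0]; its entropy and [log2 0]
      are both [-oo].

    The statements about a degree sequence follow because the denominator of
    the bound depends on the degrees only and the logarithm is increasing. *)

(** * Symmetric nonnegative matrices *)

Section SymmetricMatrix.
Context {R : realType} {n : nat}.
Implicit Types (A : 'M[R]_n) (u v x y : 'rV[R]_n).

(** With [A = 1%:M] this is the scalar product; the squared norm is written
    [bform 1%:M u u], so that one set of lemmas serves both forms. *)
Definition bform A u v : R := (u *m A *m v^T) 0 0.

Lemma bformE A u v :
  bform A u v = \sum_j (\sum_i u 0 i * A i j) * v 0 j.
Proof.
rewrite /bform mxE; apply: eq_bigr => j _.
by rewrite !mxE.
Qed.

Lemma bformC A u v : A^T = A -> bform A u v = bform A v u.
Proof.
move=> As; rewrite /bform -[in LHS](trmxK (u *m A *m v^T)) mxE.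
by rewrite trmx_mul trmx_mul trmxK As mulmxA.
Qed.

Lemma bformDl A u v y : bform A (u + v) y = bform A u y + bform A v y.
Proof. by rewrite /bform !mulmxDl mxE. Qed.

Lemma bformZl A t u y : bform A (t *: u) y = t * bform A u y.
Proof. by rewrite /bform -!scalemxAl mxE. Qed.

Lemma bform_addscale A u v t : A^T = A ->
  bform A (u + t *: v) (u + t *: v) =
    bform A u u + 2 * t * bform A u v + t ^+ 2 * bform A v v.
Proof.
move=> As; rewrite bformDl bformZl (bformC u) // (bformC v) //.
by rewrite !bformDl !bformZl (bformC v u) //; ring.
Qed.

Lemma bformZ A u t : A^T = A ->
  bform A (t *: u) (t *: u) = t ^+ 2 * bform A u u.
Proof. by move=> As; rewrite bformZl bformC // bformZl mulrA. Qed.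

Lemma bform1E u : bform 1%:M u u = \sum_j u 0 j ^+ 2.
Proof.
by rewrite /bform mulmx1 mxE; apply: eq_bigr => j _; rewrite mxE -expr2.
Qed.

Lemma bform1_ge0 u : 0 <= bform 1%:M u u.
Proof. by rewrite bform1E sumr_ge0 // => j _; rewrite sqr_ge0. Qed.

Lemma bform1_eq0 u : bform 1%:M u u = 0 -> u = 0.
Proof.
rewrite bform1E => /eqP; rewrite psumr_eq0 => [/allP u0|j _]; last first.
  exact: sqr_ge0.
apply/rowP => j; rewrite mxE; have := u0 j (mem_index_enum _).
by rewrite /= sqrf_eq0 => /eqP.
Qed.

Lemma continuous_bform A : continuous (fun u : 'rV[R]_n => bform A u u).
Proof.
rewrite (_ : (fun u => _) =
   fun u => \sum_j (\sum_i u 0 i * A i j) * u 0 j); last first.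
  by apply/funext => u; rewrite bformE.
have cM (f g : 'rV[R]_n -> R) : continuous f -> continuous g ->
    continuous (fun u => f u * g u).
  by move=> cf cg u; apply: (@continuousM R _ f g u); [exact: cf|exact: cg].
have cS (f : 'I_n -> 'rV[R]_n -> R) : (forall i, continuous (f i)) ->
    continuous (fun u => \sum_i f i u).
  move=> cf; apply: continuous_big => [|i _]; first exact: add_continuous.
  exact: cf.
have cC i : continuous (fun u : 'rV[R]_n => u 0 i) by exact: coord_continuous.
apply: (cS (fun j u => (\sum_i u 0 i * A i j) * u 0 j)) => j.
apply: (cM (fun u => \sum_i u 0 i * A i j)) => //.
apply: (cS (fun i u => u 0 i * A i j)) => i.
by apply: (cM _ (fun=> A i j)) => //; exact: cst_continuous.
Qed.

Lemma compact_sphere : compact [set u : 'rV[R]_n | bform 1%:M u u = 1].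
Proof.
apply: (@subclosed_compact _ _
  [set u : 'rV[R]_n | forall j, `[-1, 1]%classic (u 0 j)]).
- apply: (@preimage_closed _ _ (fun u : 'rV[R]_n => bform 1%:M u u) [set 1]).
    by move=> u _; exact: continuous_bform.
  exact: closed_eq.
- have cube := @rV_compact R n (fun=> `[-1, 1]%classic)
    (fun=> @segment_compact R (-1) 1).
  exact: cube.
- move=> u /=; rewrite bform1E => u1 j.
  rewrite in_itv /= -ler_norml -(@expr_le1 _ 2%N) //.
  rewrite real_normK ?num_real //.
  rewrite -u1 (bigD1 j) //= lerDl sumr_ge0 // => i _; exact: sqr_ge0.
Qed.

Lemma le_bform_norm A x : (forall i j, 0 <= A i j) ->
  bform A x x <= bform A (map_mx Num.norm x) (map_mx Num.norm x).
Proof.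
move=> A0; rewrite !bformE; apply: ler_sum => j _; rewrite !mulr_suml.
apply: ler_sum => i _; rewrite !mxE.
rewrite (le_trans (ler_norm _)) // !normrM (ger0_norm (A0 i j)) //.
Qed.

Lemma bform1_norm x :
  bform 1%:M (map_mx Num.norm x) (map_mx Num.norm x) = bform 1%:M x x.
Proof.
rewrite !bform1E; apply: eq_bigr => j _; rewrite mxE.
by rewrite real_normK ?num_real.
Qed.

(** A vector where the bound [u A u^T <= m u u^T] is attained is a critical
    point of the difference [u A u^T - m u u^T]: moving from [x] in the
    direction of the residual [r = x A - m x] changes the difference at the
    rate [2 |r|^2], which would make it positive unless [r = 0]. *)
Lemma rayleigh_critical A m x : A^T = A ->
  (forall u, bform A u u <= m * bform 1%:M u u) ->
  bform A x x = m * bform 1%:M x x -> x *m A = m *: x.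
Proof.
move=> As le_m xm; set r := x *m A - m *: x.
have rE : bform A x r - m * bform 1%:M x r = bform 1%:M r r.
  rewrite /bform !mulmx1 {3}/r mulmxBl -scalemxAl [RHS]mxE; congr (_ + _).
  by rewrite [RHS]mxE [X in _ = - X]mxE.
set K := m * bform 1%:M r r - bform A r r.
have K0 : 0 <= K by rewrite subr_ge0.
have ineq t : 2 * t * bform 1%:M r r <= t ^+ 2 * K.
  have := le_m (x + t *: r).
  have -> : bform 1%:M r r = bform A x r - m * bform 1%:M x r by [].
  rewrite !bform_addscale ?trmx1 // xm /K; lra.
have /bform1_eq0/eqP : bform 1%:M r r = 0; last by rewrite subr_eq0 => /eqP.
apply/eqP; rewrite eq_le bform1_ge0 andbT leNgt; apply/negP => r0.
have K1 : 0 < K + 1 by lra.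
(* For small t the linear term wins; t = |r|^2 / (K + 1) is small enough,
   the 1 being there because K may vanish. *)
have := ineq (bform 1%:M r r / (K + 1)).
set N := bform _ _ _ in r0 *.
rewrite (_ : _ * N = (N / (K + 1)) ^+ 2 * (2 * (K + 1))); last first.
  by field; rewrite gt_eqF.
rewrite ler_pM2l; first lra.
by rewrite exprn_gt0 // divr_gt0.
Qed.

(** The existence half of Perron-Frobenius, by maximizing the quadratic form on
    the unit sphere; nonnegativity of [A] allows a maximizer to be replaced by
    its entrywise absolute value. *)
Lemma nonneg_eigenvector A : (0 < n)%N -> A^T = A -> (forall i j, 0 <= A i j) ->
  exists m x, [/\ x *m A = m *: x, x != 0 & forall i, 0 <= x 0 i].
Proof.
move=> n0 As A0; pose S := [set u : 'rV[R]_n | bform 1%:M u u = 1].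
have S0 : S !=set0.
  exists (delta_mx 0 (Ordinal n0)); rewrite /S /= bform1E.
  rewrite (bigD1 (Ordinal n0)) //= mxE !eqxx /= expr1n big1 ?addr0 // => i i0.
  by rewrite mxE eqxx (negbTE i0) expr0n.
have [c] := compact_EVT_max S0 compact_sphere
  (continuous_subspaceT (@continuous_bform A)).
rewrite inE /S /= => c1 cmax.
pose x : 'rV[R]_n := map_mx Num.norm c.
have x1 : bform 1%:M x x = 1 by rewrite bform1_norm.
have le_m u : bform A u u <= bform A x x * bform 1%:M u u.
  have [u0|u0] := eqVneq (bform 1%:M u u) 0.
    by rewrite (bform1_eq0 u0) /bform !mul0mx !mxE mulr0.
  have {u0}N0 : 0 < bform 1%:M u u by rewrite lt_def u0 bform1_ge0.
  pose s := Num.sqrt (bform 1%:M u u).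
  have s2 : s ^+ 2 = bform 1%:M u u by rewrite sqr_sqrtr // ltW.
  have s0 : s != 0 by rewrite sqrtr_eq0 -ltNge.
  have : bform A (s^-1 *: u) (s^-1 *: u) <= bform A c c.
    apply: cmax; rewrite inE /S /= bformZ ?trmx1 // -s2 exprVn mulVf //.
    by rewrite expf_neq0.
  rewrite bformZ // exprVn s2 ler_pdivrMl // mulrC => h.
  by rewrite (le_trans h) // ler_pM2r // le_bform_norm.
exists (bform A x x), x; split.
- by apply: rayleigh_critical; rewrite ?x1 ?mulr1.
- apply/eqP => x0; move: x1; rewrite x0 /bform !mul0mx mxE => /eqP.
  by rewrite eq_sym oner_eq0.
- by move=> i; rewrite mxE.
Qed.

(** The quadratic form [m u u^T - u A u^T] is half the sum of the squares
    [A_ij (u_j x_i - u_i x_j)^2 / (x_i x_j)]. *)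
Lemma rayleigh_le A m x u : A^T = A -> (forall i j, 0 <= A i j) ->
  (forall i, 0 < x 0 i) -> x *m A = m *: x ->
  bform A u u <= m * bform 1%:M u u.
Proof.
move=> As A0 x0 xA.
have Aij i j : A i j = A j i by rewrite -[in RHS]As mxE.
have xAj j : \sum_i x 0 i * A i j = m * x 0 j.
  by move/rowP/(_ j): xA; rewrite !mxE.
pose w i j := u 0 j ^+ 2 * (x 0 i / x 0 j) * A i j.
have wE : \sum_j \sum_i w i j = m * bform 1%:M u u.
  rewrite bform1E mulr_sumr; apply: eq_bigr => j _.
  transitivity (u 0 j ^+ 2 / x 0 j * \sum_i x 0 i * A i j).
    by rewrite mulr_sumr; apply: eq_bigr => i _; rewrite /w; ring.
  by rewrite xAj; field; rewrite gt_eqF.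
(* The double sum taken in both orders: pairing the terms (i, j) and (j, i)
   completes the square. *)
have wE' : \sum_j \sum_i w j i = m * bform 1%:M u u.
  by rewrite exchange_big.
have : 2 * bform A u u <= m * bform 1%:M u u + m * bform 1%:M u u.
  rewrite -{1}wE -wE' bformE -big_split mulr_sumr; apply: ler_sum => j _ /=.
  rewrite -big_split mulr_suml mulr_sumr; apply: ler_sum => i _ /=.
  rewrite /w (Aij j i) -subr_ge0.
  move: (x0 i) (x0 j) (A0 i j); move: (x 0 i) (x 0 j) (A i j) => p q c p0 q0 c0.
  move: (u 0 i) (u 0 j) => s t.
  have -> : t ^+ 2 * (p / q) * c + s ^+ 2 * (q / p) * c - 2 * (s * c * t) =
     c * (t * p - s * q) ^+ 2 / (p * q).
    by field; rewrite !gt_eqF.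
  by apply: divr_ge0; apply: mulr_ge0; rewrite ?sqr_ge0 // ltW.
lra.
Qed.

(** Taking absolute values in [y A = z y] gives [|z| |y| <= |y| A] entrywise,
    and pairing with the positive vector [x] turns the right side into
    [m |y| x^T]; the pairing [|y| x^T] is positive and cancels. *)
Lemma complex_eigenvalue_le A m x (z : R[i]) :
  A^T = A -> (forall i j, 0 <= A i j) ->
  (forall i, 0 < x 0 i) -> x *m A = m *: x ->
  eigenvalue (map_mx (real_complex R) A) z -> `|z| <= (m%:C)%C.
Proof.
move=> As A0 x0 xA /eigenvalueP[y yA y0].
have Aij i j : A i j = A j i by rewrite -[in RHS]As mxE.
have xAj j : \sum_i x 0 i * A i j = m * x 0 j.
  by move/rowP/(_ j): xA; rewrite !mxE.
have x0c i : 0 < ((x 0 i)%:C)%C by rewrite ltcR.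
pose T := \sum_j `|y 0 j| * ((x 0 j)%:C)%C.
have T0 : 0 < T.
  have /rV0Pn[j yj] := y0.
  rewrite /T (bigD1 j) //= ltr_wpDr ?mulr_gt0 ?normr_gt0 //.
  by apply: sumr_ge0 => i _; rewrite mulr_ge0 // ltW.
rewrite -(ler_pM2r T0) {1}/T mulr_sumr.
have step j : `|z| * `|y 0 j| <= \sum_i `|y 0 i| * ((A i j)%:C)%C.
  have yj : \sum_i y 0 i * ((A i j)%:C)%C = z * y 0 j.
    move/rowP/(_ j): yA; rewrite !mxE => <-.
    by apply: eq_bigr => i _; rewrite !mxE.
  rewrite -normrM -yj (le_trans (ler_norm_sum _ _ _)) //.
  apply: ler_sum => i _; rewrite normrM.
  by rewrite [X in _ * X]ger0_norm // lecR.
apply: (@le_trans _ _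
  (\sum_j \sum_i `|y 0 i| * ((A i j)%:C)%C * ((x 0 j)%:C)%C)).
  apply: ler_sum => j _; rewrite mulrA -mulr_suml.
  by rewrite ler_pM2r.
rewrite exchange_big /T mulr_sumr; apply: ler_sum => i _ /=.
rewrite mulrCA -rmorphM -xAj rmorph_sum mulr_sumr.
rewrite (eq_bigr (fun j => `|y 0 i| * ((x 0 j * A j i)%:C)%C)) // => j _.
by rewrite -mulrA -rmorphM Aij mulrC [(x 0 j * _)%R]mulrC mulrC.
Qed.

Lemma spectral_radius_perron A m x :
  (0 < n)%N -> A^T = A -> (forall i j, 0 <= A i j) ->
  (forall i, 0 < x 0 i) -> x *m A = m *: x -> spectral_radius A = m.
Proof.
move=> n0 As A0 x0 xA.
have xn0 : x != 0.
  by apply/rV0Pn; exists (Ordinal n0); rewrite gt_eqF.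
have le_m z : eigenvalue (map_mx (real_complex R) A) z -> complex.Re `|z| <= m.
  move=> /(complex_eigenvalue_le As A0 x0 xA).
  by rewrite lecE /= => /andP[].
have m0 : 0 <= m.
  have : 0 <= m * x 0 (Ordinal n0).
    move/rowP/(_ (Ordinal n0)): xA; rewrite !mxE => <-.
    by apply: sumr_ge0 => i _; rewrite mulr_ge0 // ltW.
  by rewrite pmulr_lge0.
have em : eigenvalue (map_mx (real_complex R) A) (m%:C)%C.
  apply/eigenvalueP; exists (map_mx (real_complex R) x).
    by rewrite -map_mxM xA map_mxZ.
  by rewrite map_mx_eq0.
have mS : [set complex.Re `|z| | z in
         [set z : R[i] | eigenvalue (map_mx (real_complex R) A) z]] m.
  by exists (m%:C)%C => //=; rewrite expr0n addr0 sqrtr_sqr ger0_norm.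
apply/eqP; rewrite eq_le; apply/andP; split.
  by apply: ge_sup; [exists m|move=> _ [z /= ez <-]; exact: le_m].
by apply: ub_le_sup => //; exists m => _ [z /= ez <-]; exact: le_m.
Qed.

End SymmetricMatrix.

(** * The Perron eigenvector of a connected graph and the degree bound *)

Section Perron.
Context {R : realType} {G : sgraph}.

Lemma adjmx_tr : (adjmx R G)^T = adjmx R G.
Proof. by apply/matrixP => i j; rewrite !mxE adj_sym. Qed.

Lemma adjmx_ge0 i j : 0 <= adjmx R G i j.
Proof. by rewrite mxE ler0n. Qed.

Lemma adjmx_mulE (x : 'rV[R]_#|G|) v :
  (x *m adjmx R G) 0 (enum_rank v) = \sum_(w | adj v w) x 0 (enum_rank w).
Proof.
rewrite mxE [RHS]big_mkcond (reindex (@enum_rank G)) /=; last first.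
  by apply: onW_bij; exact: enum_rank_bij.
apply: eq_bigr => w _; rewrite mxE !enum_rankK adj_sym.
by case: adj; rewrite ?mulr1 ?mulr0.
Qed.

(** The zero set of a nonnegative eigenvector is closed under adjacency, because
    a sum of nonnegative entries over the neighbours vanishes only if each of
    them does; in a connected graph it is therefore empty. *)
Lemma perron_vector : connected_graph G ->
  exists2 x : 'rV[R]_#|G|, x *m adjmx R G = lambda R G *: x
                         & forall i, 0 < x 0 i.
Proof.
move=> [n0 Gc].
have [m [x [xA x0 xge0]]] := nonneg_eigenvector n0 adjmx_tr adjmx_ge0.
have x_gt0 i : 0 < x 0 i.
  rewrite lt_def xge0 andbT; apply/eqP => xi0.
  pose Z := [pred v : G | x 0 (enum_rank v) == 0].
  have Zclosed : fingraph.closed (@adj G) Z.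
    apply: (intro_closed (sym_connect_sym (@adj_sym G))) => v w vw /eqP xv0.
    move/rowP/(_ (enum_rank v))/eqP: xA.
    rewrite adjmx_mulE mxE xv0 mulr0 psumr_eq0 // => /allP/(_ w).
    by rewrite mem_index_enum vw => /(_ isT).
  case/eqP: x0; apply/rowP => j; rewrite mxE; apply/eqP.
  have := closed_connect Zclosed (Gc (enum_val i) (enum_val j)).
  by rewrite !inE !enum_valK xi0 eqxx => /esym.
exists x => //.
by rewrite /lambda (spectral_radius_perron n0 adjmx_tr adjmx_ge0 x_gt0 xA).
Qed.

Lemma lambda_largest : connected_graph G ->
  is_largest_eigenvalue (adjmx R G) (lambda R G).
Proof.
move=> Gc; have [x xA x0] := perron_vector Gc.
split=> [|l /eigenvalueP[y yA y0]].
  apply/eigenvalueP; exists x => //; have [n0 _] := Gc.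
  by apply/rV0Pn; exists (Ordinal n0); rewrite gt_eqF.
have := rayleigh_le y adjmx_tr adjmx_ge0 x0 xA.
rewrite [X in X <= _](_ : _ = l * bform 1%:M y y); last first.
  by rewrite /bform yA mulmx1 -scalemxAl mxE.
rewrite ler_pM2r // lt_def bform1_ge0 andbT.
by apply: contraNneq y0 => /bform1_eq0 ->.
Qed.

(** Every edge is the image of exactly two adjacent ordered pairs, distinct
    because the graph has no loops. *)
Lemma sum_adj_randic (a : R) :
  \sum_(v : G) \sum_(w | adj v w) (deg v)%:R `^ a * (deg w)%:R `^ a =
  2 * randic a G.
Proof.
rewrite pair_big_dep /= /randic mulr_sumr.
pose h (p : G * G) := [set p.1; p.2]%SET.
rewrite (partition_big_imset h [pred p : G * G | adj p.1 p.2]) /=.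
apply: eq_bigr => _ /imsetP[[v w] /= vw ->]; rewrite inE /= in vw.
have vNw : v != w by apply: contraTneq vw => ->; rewrite adj_irrefl.
rewrite (bigD1 (v, w)) /=; last by rewrite inE vw eqxx.
rewrite (bigD1 (w, v)) /=; last first.
  rewrite inE /= adj_sym vw /h /= finset.setUC eqxx.
  by rewrite xpair_eqE negb_and vNw orbT.
rewrite big1 ?addr0; last first.
  move=> [s t]; rewrite inE /= !xpair_eqE.
  move=> /andP[/andP[/andP[st /eqP hE] n1] n2].
  have sNt : s != t by apply: contraTneq st => ->; rewrite adj_irrefl.
  have : s \in h (v, w) by rewrite -hE !inE eqxx.
  have : t \in h (v, w) by rewrite -hE !inE eqxx orbT.
  rewrite !inE /= => /orP[]/eqP tE /orP[]/eqP sE; move: n1 n2 sNt;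
  by rewrite tE sE ?eqxx.
rewrite big_setU1 ?inE //= big_set1 natrM powRM ?ler0n //; ring.
Qed.

Lemma bform_powdeg (a : R) :
  let u := \row_i (deg (enum_val i : G))%:R `^ a in
  bform (adjmx R G) u u = 2 * randic a G /\
  bform 1%:M u u = \sum_(v : G) (deg v)%:R `^ (2 * a).
Proof.
move=> u; split.
  rewrite bformE -sum_adj_randic [RHS](reindex (@enum_val G G)) /=; last first.
    by apply: onW_bij; exact: enum_val_bij.
  apply: eq_bigr => j _; rewrite mulr_suml.
  rewrite [RHS]big_mkcond [RHS](reindex (@enum_val G G)) /=; last first.
    by apply: onW_bij; exact: enum_val_bij.
  apply: eq_bigr => i _; rewrite !mxE adj_sym.
  by case: adj; rewrite ?mulr1 ?mulr0 ?mul0r // mulrC.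
rewrite bform1E [RHS](reindex (@enum_val G G)) /=; last first.
  by apply: onW_bij; exact: enum_val_bij.
by apply: eq_bigr => j _; rewrite mxE mulrC powRrM powR_mulrn ?powR_ge0.
Qed.

Lemma randic_le_lambda (a : R) : connected_graph G ->
  2 * randic a G / (\sum_(v : G) ((deg v)%:R `^ (2 * a))) <= lambda R G.
Proof.
move=> Gc; have [x xA x0] := perron_vector Gc.
have [<- <-] := bform_powdeg a; set u := \row_i _.
have [/bform1_eq0 u0|N0] := eqVneq (bform 1%:M u u) 0.
  (* Division by zero: the quotient is 0, below the nonnegative lambda. *)
  rewrite u0 /bform !mul0mx mxE mul0r.
  have : 0 <= (x *m adjmx R G) 0 (Ordinal Gc.1).
    rewrite mxE; apply: sumr_ge0 => i _.
    by rewrite mulr_ge0 ?adjmx_ge0 // ltW.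
  by rewrite xA mxE pmulr_lge0.
rewrite ler_pdivrMr ?lt_def ?N0 ?bform1_ge0 //.
exact: rayleigh_le adjmx_tr adjmx_ge0 x0 xA.
Qed.

End Perron.

(** * Counting walks *)

Section Walks.
Context {G : sgraph}.

(** A finite walk extends to a bi-infinite one by iterating [f] from its last
    vertex to the right and, adjacency being symmetric, from its first vertex to
    the left. *)
Lemma blocks_walks (f : G -> G) k : (forall v, adj v (f v)) ->
  blocks G k.+1 = [set w : k.+1.-tuple G | sorted (@adj G) w]%SET.
Proof.
move=> adjf; apply/setP => w; rewrite !inE; apply/asboolP/idP.
  move=> [x [xwalk [m wE]]]; apply/(sortedP (thead w)) => i.
  rewrite size_tuple => ik.
  have ik' := ltnW ik.
  rewrite -(tnth_nth _ _ (Ordinal ik')) -(tnth_nth _ _ (Ordinal ik)) !wE /=.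
  by rewrite intS [1 + _]addrC addrA.
move=> /(sortedP (thead w)) ws; rewrite size_tuple in ws.
pose y n := if (n <= k)%N then nth (thead w) w n
            else iter (n - k) f (nth (thead w) w k).
pose x (i : int) :=
  match i with Posz n => y n | Negz n => iter n.+1 f (nth (thead w) w 0) end.
exists x; split; last first.
  exists 0 => j; rewrite add0r /x /y -ltnS ltn_ord.
  by rewrite (tnth_nth (thead w)).
case=> n; rewrite /x.
  rewrite -PoszD addn1 /y; case: (ltngtP n k) => [nk|nk|->].
  - exact: ws.
  - by rewrite (subSn (ltnW nk)) /=.
  - by rewrite subSn // subnn.
rewrite (_ : Negz n + 1 = - (n%:Z)); last lia.
by case: n => [|n]; rewrite ?oppr0 /= /y /= adj_sym.
Qed.

Lemma big_tuple_cons (R : nmodType) k (P : pred (k.+1.-tuple G)) F :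
  \sum_(w | P w) F w =
  \sum_v \sum_(t : k.-tuple G | P [tuple of v :: t]) F [tuple of v :: t] :> R.
Proof.
rewrite pair_big_dep /=.
rewrite (reindex (fun p : G * k.-tuple G => [tuple of p.1 :: p.2])) //=.
exists (fun w : k.+1.-tuple G => (thead w, [tuple of behead w])).
  by move=> [v t] _ /=; congr (_, _); apply: val_inj.
by move=> w _; rewrite -tuple_eta.
Qed.

(** Weighting a walk by the eigenvector at its last vertex makes the count
    exact: summing over the last step multiplies the total weight by [m]. *)
Lemma sum_walks (R : comNzRingType) (h : G -> R) m :
  (forall v, \sum_(w | adj v w) h w = m * h v) ->
  forall k v,
    \sum_(t : k.-tuple G | path (@adj G) v t) h (last v t) = m ^+ k * h v.
Proof.
move=> hm; elim=> [|k IH] v.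
  rewrite (eq_bigl (pred1 [tuple])) => [|t].
    by rewrite big_pred1_eq mul1r.
  by rewrite (tuple0 t) /= eqxx.
rewrite big_tuple_cons exprSr -mulrA -hm mulr_sumr [RHS]big_mkcond.
apply: eq_bigr => w _ /=; case: ifP => vw; last by rewrite big_pred0.
by rewrite -IH.
Qed.

(** The weights [h v] lie between the positive constants [1 / T] and [S], so the
    exact weighted count controls the plain count. *)
Lemma card_blocks_bounds (R : realFieldType) (f : G -> G) (h : G -> R) m :
  (0 < #|G|)%N -> (forall v, adj v (f v)) -> (forall v, 0 < h v) ->
  (forall v, \sum_(w | adj v w) h w = m * h v) -> 0 < m ->
  exists c C, [/\ 0 < c, 0 < C &
    forall k, c * m ^+ k <= #|blocks G k.+1|%:R <= C * m ^+ k].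
Proof.
move=> /card_gt0P[v0 _] adjf h0 hm m0.
pose S := \sum_v h v; pose T := \sum_v (h v)^-1.
have S_ge v : h v <= S.
  by rewrite /S (bigD1 v) //= lerDl sumr_ge0 // => w _; rewrite ltW.
have T_ge v : (h v)^-1 <= T.
  by rewrite /T (bigD1 v) //= lerDl sumr_ge0 // => w _; rewrite invr_ge0 ltW.
have S0 : 0 < S by rewrite (lt_le_trans (h0 v0)).
have T0 : 0 < T by rewrite (lt_le_trans _ (T_ge v0)) ?invr_gt0.
have total k : \sum_(w in blocks G k.+1) h (last (thead w) w) = S * m ^+ k.
  rewrite (blocks_walks _ adjf) big_tuple_cons /S mulr_suml.
  apply: eq_bigr => v _; rewrite mulrC -(sum_walks hm).
  by apply: eq_bigl => t; rewrite inE.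
(* The lower constant is 1 because S is both an upper bound of the weights and
   the total weight of the walks without steps. *)
exists 1, (T * S); split=> // [|k]; first by rewrite mulr_gt0.
have := total k; set B := blocks G k.+1 => BE.
have up : S * m ^+ k <= S * #|B|%:R.
  rewrite -BE -sum1_card natr_sum mulr_sumr; apply: ler_sum => w _.
  by rewrite mulr1.
have lo : #|B|%:R <= T * (S * m ^+ k).
  rewrite -BE -sum1_card natr_sum mulr_sumr; apply: ler_sum => w _.
  by rewrite -ler_pdivrMr // mul1r.
by rewrite mul1r -mulrA lo andbT -(ler_pM2l S0).
Qed.

End Walks.

Lemma cvg_growth_rate (R : realType) (u : nat -> R) c C m :
  0 < c -> 0 < C -> 0 < m ->
  (forall k, c * m ^+ k <= u k <= C * m ^+ k) ->
  (k.+1%:R^-1 * ln (u k)) @[k --> \oo] --> ln m.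
Proof.
move=> c0 C0 m0 cuC.
have lim (b : R) : harmonic k * b + ln m @[k --> \oo] --> ln m.
  rewrite -[X in _ --> X]add0r -(mul0r b).
  by apply: cvgD; [apply: cvgMl; exact: cvg_harmonic|exact: cvg_cst].
have lnE (b : R) k : 0 < b ->
    k.+1%:R^-1 * ln (b * m ^+ k) = harmonic k * ln (b / m) + ln m.
  move=> b0; rewrite ln_div ?posrE // lnM ?posrE ?exprn_gt0 // lnXn //.
  rewrite /harmonic /= -mulr_natr -natr1; field.
  by rewrite natr1 pnatr_eq0.
apply: squeeze_cvgr (lim (ln (c / m))) (lim (ln (C / m))).
near=> k; rewrite -!lnE //; have /andP[lo up] := cuC k.
have mk0 : 0 < m ^+ k by rewrite exprn_gt0.
have u0 : 0 < u k by rewrite (lt_le_trans _ lo) // mulr_gt0.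
by rewrite !ler_pM2l ?invr_gt0 ?ltr0n // !ler_ln ?posrE ?mulr_gt0 // lo.
Unshelve. all: by end_near. Qed.

(** * Topological entropy *)

Section Log2e.
Context {R : realType}.
Implicit Types x y : R.

Lemma ln2_gt0 : 0 < ln 2 :> R.
Proof. by rewrite ln_gt0 // ltr1n. Qed.

Lemma log2e_gt0 x : 0 < x -> log2e x = (ln x / ln 2)%:E.
Proof. by move=> x0; rewrite /log2e lne_EFin. Qed.

Lemma log2e_le0 x : x <= 0 -> log2e x = -oo%E.
Proof.
move=> x0; rewrite /log2e le0_lneNy ?lee_fin //.
by rewrite gt0_mulNye // lte_fin invr_gt0 ln2_gt0.
Qed.

Lemma lt_log2e x y : 0 < y -> x < y -> (log2e x < log2e y)%E.
Proof.
move=> y0 xy; rewrite (log2e_gt0 y0); have [x0|x0] := leP x 0.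
  by rewrite log2e_le0 // ltNyr.
by rewrite log2e_gt0 // lte_fin ltr_pM2r ?invr_gt0 ?ln2_gt0 // ltr_ln.
Qed.

Lemma le_log2e x y : x <= y -> (log2e x <= log2e y)%E.
Proof.
rewrite le_eqVlt => /predU1P[->//|xy]; have [y0|y0] := leP y 0.
  by rewrite !log2e_le0 // (le_trans _ y0) // ltW.
by rewrite ltW // lt_log2e.
Qed.

End Log2e.

Lemma block_rate_cvg (R : realType) (G : sgraph) : connected_graph G ->
  block_rate R G k @[k --> \oo] --> log2e (lambda R G).
Proof.
move=> Gc; have [x xA x0] := perron_vector (R := R) Gc; have [n0 con] := Gc.
pose h (v : G) : R := x 0 (enum_rank v).
have hm v : \sum_(w | adj v w) h w = lambda R G * h v.
  by rewrite -adjmx_mulE xA mxE.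
have h0 v : 0 < h v by exact: x0.
rewrite -cvg_shiftS.
have [n1|n1] := leqP #|G| 1%N.
  have noadj (v w : G) : adj v w = false.
    by rewrite (fintype_le1P n1 v w) adj_irrefl.
  have lam0 : lambda R G = 0.
    have /card_gt0P[v _] := n0; have := hm v.
    rewrite big1 => [/esym/eqP|w]; last by rewrite noadj.
    by rewrite mulf_eq0 (gt_eqF (h0 v)) orbF => /eqP.
  rewrite lam0 log2e_le0 // (_ : [sequence _]_k = fun=> -oo%E).
    exact: cvg_cst.
  apply/funext => k; rewrite /block_rate /= (_ : blocks G k.+1 = finset.set0).
    by rewrite cards0 log2e_le0 // gt0_muleNy // lte_fin invr_gt0 ltr0n.
  apply/setP => w; rewrite !inE; apply/asboolP => -[y [ywalk _]].
  by have := ywalk 0; rewrite noadj.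
(* From here on there are at least two vertices. *)
have ex_adj (v : G) : exists w, adj v w.
  have /card_gt1P[s [t [_ _ st]]] := n1.
  have [w wv] : exists w : G, w != v.
    by have [<-|] := eqVneq s v; [exists t; rewrite eq_sym|exists s].
  have /connectP[[|u p] /=] := con v w.
    by move=> _ e; rewrite e eqxx in wv.
  by move=> /andP[vu _] _; exists u.
pose f (v : G) := xchoose (ex_adj v).
have adjf v : adj v (f v) by exact: xchooseP.
have lam0 : 0 < lambda R G.
  have /card_gt0P[v _] := n0; rewrite -(pmulr_lgt0 _ (h0 v)) -hm.
  rewrite (bigD1 (f v)) //= ltr_wpDr // sumr_ge0 // => w _; exact: ltW.
have [c [C [c0 C0 cBC]]] := card_blocks_bounds n0 adjf h0 hm lam0.
rewrite log2e_gt0 //.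
have B0 k : 0 < #|blocks G k.+1|%:R :> R.
  have /andP[lo _] := cBC k.
  by rewrite (lt_le_trans _ lo) // mulr_gt0 // exprn_gt0.
rewrite (_ : [sequence _]_k =
    EFin \o (fun k => k.+1%:R^-1 * ln #|blocks G k.+1|%:R / ln 2)); last first.
  by apply/funext => k; rewrite /block_rate /= log2e_gt0 // -EFinM mulrA.
apply: cvg_EFin; first by near=> k.
by apply: cvgMl; exact: cvg_growth_rate c0 C0 lam0 cBC.
Unshelve. all: by end_near. Qed.

Lemma entropyE (R : realType) (G : sgraph) : connected_graph G ->
  entropy R G = log2e (lambda R G).
Proof. by move=> Gc; apply/cvg_lim => //; exact: block_rate_cvg. Qed.

Lemma entropy_boundE (R : realType) (a r : R) (p : seq nat) (G : sgraph) :
  in_class p G ->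
  entropy_bound a p r = log2e (2 * r / \sum_(v : G) ((deg v)%:R `^ (2 * a))).
Proof.
move=> [_ Gp]; rewrite /entropy_bound -(perm_big _ Gp) big_map.
by rewrite big_enum.
Qed.

Theorem proposition1 (R : realType) (a : R) :
  (forall G : sgraph, connected_graph G ->
     [/\ is_largest_eigenvalue (adjmx R G) (lambda R G),
         2 * randic a G / (\sum_(v : G) ((deg v)%:R `^ (2 * a))) <= lambda R G,
         cvgn (block_rate R G)
       & entropy R G = log2e (lambda R G)])
  /\
  (forall p : seq nat, degree_sequence p ->
     (forall (G : sgraph) (r : R), in_class p G -> r <= randic a G ->
        (entropy_bound a p r <= entropy R G)%E) /\
     (forall G G' : sgraph, in_class p G -> in_class p G' ->
        randic a G < randic a G' ->
        (entropy_bound a p (randic a G) < entropy_bound a p (randic a G'))%E)).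
Proof.
split=> [G Gc|p _].
  split; [exact: lambda_largest|exact: randic_le_lambda| |exact: entropyE].
  by apply/cvg_ex; exists (log2e (lambda R G)); exact: block_rate_cvg.
split=> [G r Gp rG|G G' Gp Gp' ltr].
  rewrite (entropy_boundE a r Gp) entropyE ?Gp.1 //; last exact: Gp.1.
  apply: le_log2e; apply: le_trans (randic_le_lambda a Gp.1).
  by rewrite ler_wpM2r ?ler_pM2l // invr_ge0 sumr_ge0.
have randic'_gt0 : 0 < randic a G'.
  by apply: le_lt_trans ltr; apply: sumr_ge0 => E _; exact: powR_ge0.
have sum_gt0 : 0 < \sum_(v : G') (deg v)%:R `^ (2 * a).
  have [AE <-] := @bform_powdeg R G' a; rewrite lt_def bform1_ge0 andbT.
  apply/eqP => /bform1_eq0 u0; move: AE; rewrite u0 /bform !mul0mx mxE => /esym.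
  by apply/eqP; rewrite gt_eqF ?mulr_gt0.
rewrite !(entropy_boundE a _ Gp'); apply: lt_log2e.
  by rewrite divr_gt0 ?mulr_gt0.
by rewrite ltr_pM2r ?invr_gt0 // ltr_pM2l.
Qed.
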